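(* There is a constant $c$ with $0<c<3-\sqrt2$ such that the following holds. Let $\kappa>0$, $\Delta t>0$, and $h=\kappa^2\Delta t/\pi$ with $h<(1/c)^2$. For any integer $N\ge1$ and any $\bm{f}\in\mathbb{R}^{N+1}$, the solution $\bm{\sigma}\in\mathbb{R}^{N+1}$ of $(I+V)\bm{\sigma}=2\bm{f}$ (with $V$ defined in the context) satisfies $$\|\bm{\sigma}\|\;\le\;\frac{2}{1-c\sqrt h}\,\|\bm{f}\| ,$$ where $\|\cdot\|$ is the $\ell^2$-norm. That is, this forward Euler marching scheme is stable for $h<0.39<(1/c)^2$, or for $\Delta t<\pi/(c^2\kappa^2)$.
   Context: $I$ is the $(N+1)\times(N+1)$ identity and $V\in\mathbb{R}^{(N+1)\times(N+1)}$ is the lower-triangular Toeplitz matrix with entries $V_{nm}=v_{n-m}$ for $n>m$ and $V_{nm}=0$ otherwise ($0\le n,m\le N$), where $$v_j=2\sqrt h\,(\sqrt j-\sqrt{j-1}),\qquad j=1,2,\dots,\qquad h=\kappa^2\Delta t/\pi .$$ This is the forward Euler (piecewise constant in time, step $\Delta t$) discretization of the Abel equation $\sigma(t)+\frac{\kappa}{\sqrt\pi}\int_0^t\frac{\sigma(\tau)}{\sqrt{t-\tau}}\,d\tau=2f(t)$, which arises from the Robin problem $\partial u/\partial\bm\nu+\kappa u=f$ for the heat equation on the half line with heat transfer coefficient $\kappa$. *)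

(* Defs.v *)
From mathcomp Require Import all_boot all_order all_algebra.
From mathcomp Require Import reals trigo.

Set Implicit Arguments.
Unset Strict Implicit.
Unset Printing Implicit Defensive.

Import Order.TTheory GRing.Theory Num.Theory.

Local Open Scope ring_scope.

(* The library norm on matrices is the sup norm, hence this definition. *)
Definition l2norm (R : realType) (n : nat) (x : 'cV[R]_n) : R :=
  Num.sqrt (\sum_(i < n) x i 0 ^+ 2).

Definition abel_h (R : realType) (kappa dt : R) : R := kappa ^+ 2 * dt / pi.

(* v_j is meant for j >= 1; the truncated predecessor makes v_0 = 0. *)
Definition abel_v (R : realType) (h : R) (j : nat) : R :=
  2 * Num.sqrt h * (Num.sqrt j%:R - Num.sqrt j.-1%:R).

Definition abel_V (R : realType) (h : R) (N : nat) : 'M[R]_N.+1 :=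
  \matrix_(n < N.+1, m < N.+1) (if (m < n)%N then abel_v h (n - m)%N else 0).

Definition euler_solution (R : realType) (h : R) (N : nat)
    (f sigma : 'cV[R]_N.+1) : Prop :=
  (1%:M + abel_V h N) *m sigma = 2 *: f.

(* Stability of the marching scheme at a fixed h: the l2 norm of the solution
   is controlled by that of the data, uniformly in the number of steps. *)
Definition euler_stable (R : realType) (h : R) : Prop :=
  exists K : R, forall (N : nat) (f sigma : 'cV[R]_N.+1),
    (1 <= N)%N -> euler_solution h f sigma -> l2norm sigma <= K * l2norm f.

Lemma abel_unitmx (R : realType) (h : R) (N : nat) :
  1%:M + abel_V h N \in unitmx.
Proof.
rewrite unitmxE det_trig; last first.
  apply/is_trig_mxP => i j ij; rewrite !mxE ltnNge (ltnW ij) /=.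
  by rewrite -val_eqE (ltn_eqF ij) addr0.
by rewrite big1 ?unitr1 // => i _; rewrite !mxE eqxx ltnn addr0.
Qed.

(* So quantifying over all solutions of the linear system is the same as
   speaking of the solution. *)
Lemma euler_solution_unique (R : realType) (h : R) (N : nat)
    (f : 'cV[R]_N.+1) : exists! sigma, euler_solution h f sigma.
Proof.
have U := abel_unitmx h N.
exists (invmx (1%:M + abel_V h N) *m (2 *: f)); split.
  by rewrite /euler_solution mulKVmx.
by move=> s <-; rewrite mulKmx.
Qed.

(* Main.v *)
(** The symmetric part of [V] is [sqrt h] times a Toeplitz form with
    coefficients [2 (sqrt j - sqrt (j - 1))], a positive, decreasing and convex
    sequence for [j >= 1].  Giving it the diagonal coefficient
    [2 (3 - sqrt 2)] is exactly what keeps the sequence convex from [j = 0] on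
    (with vanishing second difference at [0]).  A convex sequence is a
    nonnegative combination of the triangles [j |-> max (k - j) 0], whose
    Toeplitz forms are the sums of the squares of all sums of [k] consecutive
    coordinates; so the form is nonnegative, which gives
    [<s, V s> >= - (3 - sqrt 2) sqrt h |s|^2].  The strict inequality
    [c < 3 - sqrt 2] comes from the windows of lengths 2 and 3: they carry
    positive weights and together control every single coordinate. *)
Require Import Defs.
From mathcomp Require Import all_boot all_order all_algebra.
From mathcomp Require Import reals trigo.
From mathcomp Require Import zify ring lra.
Import Order.TTheory GRing.Theory Num.Theory.
Local Open Scope ring_scope.

(** * Toeplitz forms and their expansion into triangles *)

Definition ndist (i j : nat) : nat := ((i - j) + (j - i))%N.

Definition toeplitz_form {R : realType} {n : nat} (a : nat -> R)
    (x : 'I_n -> R) : R :=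
  \sum_(i < n) \sum_(j < n) a (ndist i j) * (x i * x j).

(** The window is [[s - k, s)], clipped to the index range; the end [s] is excluded. *)
Definition window_sum {R : realType} {n : nat} (x : 'I_n -> R) (k s : nat) : R :=
  \sum_(i < n | (i < s <= i + k)%N) x i.

Definition second_diff {R : realType} (a : nat -> R) (k : nat) : R :=
  a k - 2 * a k.+1 + a k.+2.

Lemma sum_itv1 (a b m : nat) : (b < m)%N ->
  (\sum_(s < m) (a < s <= b) = b - a)%N.
Proof.
elim: m a b => // m IHm a b; rewrite ltnS leq_eqVlt => /orP[/eqP ->|bm].
  rewrite big_ord_recr /= leqnn andbT.
  case: m IHm => [|m] IHm; first by rewrite big_ord0.
  rewrite (eq_bigr (fun s : 'I_m.+1 => (a < s <= m)%N : nat)).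
    by rewrite IHm //; lia.
  by move=> s _; congr (nat_of_bool (_ && _)); have := ltn_ord s; lia.
by rewrite big_ord_recr /= IHm //; lia.
Qed.

(** The coefficient [k - |i - j|], truncated at 0, counts the windows of length [k] that contain
    both [i] and [j]; the bound on [S] ensures that none is missed. *)
Lemma triangle_form (R : realType) (n k S : nat) (x : 'I_n -> R) :
  (n + k <= S)%N ->
  toeplitz_form (fun j => (k - j)%:R) x = \sum_(s < S) window_sum x k s ^+ 2.
Proof.
move=> nkS; transitivity (\sum_(s < S) \sum_(i < n) \sum_(j < n)
  ((i < s <= i + k) && (j < s <= j + k))%N%:R * (x i * x j)); last first.
  apply: eq_bigr => s _; rewrite expr2 /window_sum [in RHS]big_mkcond /= mulr_suml.
  apply: eq_bigr => i _; rewrite mulr_sumr; apply: eq_bigr => j _.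
  by case: (i < s <= i + k)%N; case: (j < s <= j + k)%N;
    rewrite /= ?mul1r ?mul0r ?mulr0.
rewrite exchange_big; apply: eq_bigr => i _.
rewrite exchange_big; apply: eq_bigr => j _.
rewrite -mulr_suml -natr_sum; congr (_%:R * _).
rewrite (eq_bigr (fun s : 'I_S => (maxn i j < s <= minn i j + k)%N : nat)).
  by rewrite sum_itv1 /ndist; have := ltn_ord i; have := ltn_ord j; lia.
by move=> s _; congr nat_of_bool; lia.
Qed.

(** Discrete Taylor expansion of [a] backwards from [m], that is, two summations by parts. The last
    two terms are the boundary terms. *)
Lemma triangle_decomposition (R : realType) (a : nat -> R) (j m : nat) :
  (j <= m)%N ->
  a j = \sum_(k < m) second_diff a k * (k.+1 - j)%:R
        + (a m - a m.+1) * (m.+1 - j)%:R + a m.+1.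
Proof.
move=> /subnKC <-; elim: (m - j)%N => {m} [|m IHm].
  rewrite addn0 big1 => [|k _]; first by rewrite subSnn; ring.
  have -> : (k.+1 - j = 0)%N by have := ltn_ord k; lia.
  by rewrite mulr0.
rewrite addnS big_ord_recr /= {1}IHm /second_diff.
have -> : ((j + m).+1 - j = m.+1)%N by lia.
have -> : ((j + m).+2 - j = m.+2)%N by lia.
by rewrite -(natr1 m.+1); ring.
Qed.

Lemma toeplitz_formD (R : realType) (n : nat) (a b : nat -> R) (x : 'I_n -> R) :
  toeplitz_form (fun j => a j + b j) x = toeplitz_form a x + toeplitz_form b x.
Proof.
rewrite /toeplitz_form -big_split; apply: eq_bigr => i _ /=.
by rewrite -big_split; apply: eq_bigr => j _ /=; rewrite mulrDl.
Qed.

Lemma toeplitz_formZ (R : realType) (n : nat) (c : R) (a : nat -> R)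
    (x : 'I_n -> R) :
  toeplitz_form (fun j => c * a j) x = c * toeplitz_form a x.
Proof.
rewrite /toeplitz_form mulr_sumr; apply: eq_bigr => i _ /=.
by rewrite mulr_sumr; apply: eq_bigr => j _ /=; rewrite -mulrA.
Qed.

Lemma toeplitz_form_sum (R : realType) (n m : nat) (a : 'I_m -> nat -> R)
    (x : 'I_n -> R) :
  toeplitz_form (fun j => \sum_(k < m) a k j) x
  = \sum_(k < m) toeplitz_form (a k) x.
Proof.
rewrite /toeplitz_form [RHS]exchange_big; apply: eq_bigr => i _ /=.
by rewrite [RHS]exchange_big; apply: eq_bigr => j _ /=; rewrite mulr_suml.
Qed.

Lemma toeplitz_form_cst (R : realType) (n : nat) (c : R) (x : 'I_n -> R) :
  toeplitz_form (fun=> c) x = c * (\sum_(i < n) x i) ^+ 2.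
Proof.
rewrite /toeplitz_form expr2 mulr_suml mulr_sumr; apply: eq_bigr => i _.
by rewrite !mulr_sumr.
Qed.

Lemma triangle_form_ge0 (R : realType) (n k : nat) (x : 'I_n -> R) :
  0 <= toeplitz_form (fun j => (k - j)%:R) x.
Proof.
by rewrite (@triangle_form _ _ _ (n + k)) // sumr_ge0 // => s _; rewrite sqr_ge0.
Qed.

Lemma toeplitz_form_convex (R : realType) (n : nat) (a : nat -> R)
    (x : 'I_n -> R) :
  (forall k, 0 <= a k) -> (forall k, a k.+1 <= a k) ->
  (forall k, 0 <= second_diff a k) ->
  second_diff a 1 * toeplitz_form (fun j => (2 - j)%:R) x
  + second_diff a 2 * toeplitz_form (fun j => (3 - j)%:R) x
  <= toeplitz_form a x.
Proof.
move=> a_ge0 a_dec a_convex.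
(* Taking [m = n + 3] exceeds all index distances and leaves three leading terms to split off, of
   window lengths 1, 2 and 3. *)
have -> : toeplitz_form a x = toeplitz_form (fun j =>
    \sum_(k < n.+3) second_diff a k * (k.+1 - j)%:R
    + (a n.+3 - a n.+4) * (n.+4 - j)%:R + a n.+4) x.
  apply: eq_bigr => i _; apply: eq_bigr => j _; congr (_ * _).
  apply: triangle_decomposition.
  by rewrite /ndist; have := ltn_ord i; have := ltn_ord j; lia.
rewrite !toeplitz_formD toeplitz_form_sum toeplitz_formZ toeplitz_form_cst.
rewrite 3!big_ord_recl /= toeplitz_formZ.
rewrite !(toeplitz_formZ _ _ (second_diff _ _)).
have H0 := mulr_ge0 (a_convex 0%N) (triangle_form_ge0 _ _ 1 x).
have Hs : 0 <= \sum_(i < n) toeplitz_form (fun j => second_diff a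
    (lift ord0 (lift ord0 (lift ord0 i)))
    * ((lift ord0 (lift ord0 (lift ord0 i))).+1 - j)%:R) x.
  by apply: sumr_ge0 => k _; rewrite toeplitz_formZ mulr_ge0 ?triangle_form_ge0.
have H1 : 0 <= (a n.+3 - a n.+4) * toeplitz_form (fun j => (n.+4 - j)%:R) x.
  by rewrite mulr_ge0 ?triangle_form_ge0 // subr_ge0.
have H2 : 0 <= a n.+4 * (\sum_(i < n) x i) ^+ 2 by rewrite mulr_ge0 ?sqr_ge0.
rewrite /bump /= in Hs *; lra.
Qed.

(* A coordinate is a window of length 3 minus the window of length 2 before it. *)
Lemma sum_sqr_le_windows (R : realType) (n : nat) (x : 'I_n -> R) :
  \sum_(i < n) x i ^+ 2 <=
  2 * (toeplitz_form (fun j => (2 - j)%:R) x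
       + toeplitz_form (fun j => (3 - j)%:R) x).
Proof.
(* Only [n] of the window squares are kept; the shift [d] aligns the ends of windows of different
   lengths. *)
have le_widen k d :
    \sum_(i < n) window_sum x k (i + d) ^+ 2
    <= toeplitz_form (fun j => (k - j)%:R) x.
  rewrite (@triangle_form _ _ _ (d + (n + k))) ?leq_addl //.
  rewrite -(big_mkord xpredT (fun s => window_sum x k s ^+ 2)).
  rewrite (@big_cat_nat _ _ _ d) ?leq_addr //=.
  rewrite [X in _ + X](_ : _ =
    \sum_(0 <= i < n + k) window_sum x k (i + d) ^+ 2); last first.
    by rewrite -{1}[d]add0n big_addn addKn.
  rewrite [X in _ + X](@big_cat_nat _ _ _ n) ?leq_addr //=.
  rewrite -(big_mkord xpredT (fun i => window_sum x k (i + d) ^+ 2)).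
  rewrite addrCA lerDl addr_ge0 // sumr_ge0 // => s _; exact: sqr_ge0.
apply: (@le_trans _ _ (\sum_(i < n)
  2 * (window_sum x 2 i ^+ 2 + window_sum x 3 (i + 1) ^+ 2))).
  apply: ler_sum => i _.
  have -> : x i = window_sum x 3 (i + 1) - window_sum x 2 i.
    rewrite /window_sum (bigD1 i) /=; last by lia.
    rewrite [X in _ + X - _](eq_bigl (fun l : 'I_n => (l < i) && (i <= l + 2))%N).
      by rewrite addrK.
    by move=> l; rewrite -val_eqE /=; lia.
  have := sqr_ge0 (window_sum x 3 (i + 1) + window_sum x 2 i); nra.
rewrite -mulr_sumr big_split /= ler_pM2l ?ltr0n //.
apply: lerD (le_widen 3%N 1%N); apply: le_trans (le_widen 2%N 0%N).
by apply: ler_sum => i _; rewrite addn0.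
Qed.

(** Folding along the diagonal yields the strictly lower triangular sum, which is the shape of
    [<s, V s>]. *)
Lemma toeplitz_form_sym (R : realType) (n : nat) (a : nat -> R) (x : 'I_n -> R) :
  toeplitz_form a x = a 0%N * \sum_(i < n) x i ^+ 2
  + 2 * \sum_(i < n) \sum_(j < n | (j < i)%N) a (i - j)%N * (x i * x j).
Proof.
set L := \sum_(i < n) \sum_(j < n | _) _.
have LE : L = \sum_(i < n) \sum_(j < n | (i < j)%N) a (j - i)%N * (x i * x j).
  rewrite /L (exchange_big_dep xpredT) //=; apply: eq_bigr => i _.
  by apply: eq_bigr => j _; rewrite (mulrC (x j)).
rewrite mulr2n mulrDl mul1r {2}LE /L mulr_sumr -!big_split /=.
apply: eq_bigr => i _; rewrite (bigD1 i) //= /ndist subnn expr2; congr (_ + _).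
rewrite (bigID (fun j : 'I_n => (j < i)%N)) /=; congr (_ + _).
  apply: eq_big => [j|j /andP[_ ji]]; first by rewrite -val_eqE /=; lia.
  by congr (a _ * _); lia.
apply: eq_big => [j|j /andP[ne ji]]; first by rewrite -val_eqE /=; lia.
by congr (a _ * _); lia.
Qed.

(** * Convexity and monotonicity of the Abel coefficients *)

Definition abel_coef (R : realType) (j : nat) : R :=
  if j is 0 then 2 * (3 - Num.sqrt 2)
  else 2 * (Num.sqrt j%:R - Num.sqrt j.-1%:R).

Lemma sqr_sqrt_nat (R : realType) (n : nat) :
  Num.sqrt (n%:R : R) * Num.sqrt n%:R = n%:R.
Proof. by rewrite -expr2 sqr_sqrtr. Qed.

Lemma sqrt2_bounds (R : realType) : 1414 / 1000 < Num.sqrt (2 : R) < 1415 / 1000.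
Proof. by have := sqr_sqrt_nat R 2; have := sqrtr_ge0 (2 : R); nra. Qed.

Lemma sqrt3_bounds (R : realType) :
  1732 / 1000 < Num.sqrt (3 : R) < 17321 / 10000.
Proof. by have := sqr_sqrt_nat R 3; have := sqrtr_ge0 (3 : R); nra. Qed.

Lemma sqrt4 (R : realType) : Num.sqrt (4 : R) = 2.
Proof. by have := sqr_sqrt_nat R 4; have := sqrtr_ge0 (4 : R); nra. Qed.

Lemma abel_coef_ge0 (R : realType) (k : nat) : 0 <= abel_coef R k.
Proof.
case: k => [|k] /=; first by have := sqrt2_bounds R; lra.
by rewrite mulr_ge0 // subr_ge0 ler_wsqrtr // ler_nat.
Qed.

Lemma abel_coef_second_diff0 (R : realType) : second_diff (abel_coef R) 0 = 0.
Proof. by rewrite /second_diff /= sqrtr0 sqrtr1; ring. Qed.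

Lemma abel_coef_convex (R : realType) (k : nat) :
  0 <= second_diff (abel_coef R) k.
Proof.
case: k => [|k]; first by rewrite abel_coef_second_diff0.
rewrite /second_diff /=.
have := sqr_sqrt_nat R k; have := sqr_sqrt_nat R k.+1.
have := sqr_sqrt_nat R k.+2; have := sqr_sqrt_nat R k.+3.
have := sqrtr_ge0 (k%:R : R); have := sqrtr_ge0 (k.+1%:R : R).
have := sqrtr_ge0 (k.+2%:R : R); have := sqrtr_ge0 (k.+3%:R : R).
have : 0 <= k%:R :> R by [].
rewrite -[k.+3%:R]natr1 -[k.+2%:R]natr1 -[k.+1%:R]natr1.
set t := k%:R; set x := Num.sqrt t; set y := Num.sqrt (t + 1).
set z := Num.sqrt (t + 1 + 1); set w := Num.sqrt (t + 1 + 1 + 1).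
move=> t0 w0 z0 y0 x0 ww zz yy xx.
have y1 : 0 < y by nra.
have z1 : 0 < z by nra.
have w1 : 0 < w by nra.
(* After squaring this is [t (t + 3) <= (t + 1) (t + 2)]. It gives [sum_le], since
   [w^2 + x^2 = z^2 + y^2]. *)
have wx : w * x <= z * y.
  rewrite -ler_sqr ?nnegrE ?mulr_ge0 // !exprMn !expr2 ww xx zz yy; nra.
have sum_le : w + x <= z + y by nra.
have E1 : (y - x) * (y + x) = 1 by nra.
have E2 : (z - y) * (z + y) = 1 by nra.
have E3 : (w - z) * (w + z) = 1 by nra.
(* The differences are inverses of [y + x], [z + y], [w + z], which grow
   concavely by [sum_le]; the inverse of a concave sequence is convex. *)
suff : 2 * (z - y) <= (y - x) + (w - z) by lra.
have -> : y - x = (y + x)^-1.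
  by apply: (mulIf (x := y + x)); [lra | rewrite E1 mulVf //; lra].
have -> : z - y = (z + y)^-1.
  by apply: (mulIf (x := z + y)); [lra | rewrite E2 mulVf //; lra].
have -> : w - z = (w + z)^-1.
  by apply: (mulIf (x := w + z)); [lra | rewrite E3 mulVf //; lra].
set p := y + x; set q := z + y; set r := w + z.
have p_gt0 : 0 < p by rewrite /p; lra.
have q_gt0 : 0 < q by rewrite /q; lra.
have r_gt0 : 0 < r by rewrite /r; lra.
have prq : p + r <= 2 * q by rewrite /p /q /r; lra.
have -> : p^-1 + r^-1 = (p + r) / (p * r) by field; lra.
rewrite ler_pdivlMr ?mulr_gt0 // mulrAC ler_pdivrMr //.
(* As [q >= (p + r) / 2], what remains is [4 p r <= (p + r)^2]. *)
clear -p_gt0 q_gt0 r_gt0 prq; have := sqr_ge0 (p - r); nra.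
Qed.

Lemma abel_coef_decr (R : realType) (k : nat) : abel_coef R k.+1 <= abel_coef R k.
Proof.
case: k => [|k] /=; first by rewrite sqrtr0 sqrtr1; have := sqrt2_bounds R; lra.
have := sqr_sqrt_nat R k; have := sqr_sqrt_nat R k.+1.
have := sqr_sqrt_nat R k.+2; have := sqrtr_ge0 (k%:R : R).
have := sqrtr_ge0 (k.+1%:R : R); have := sqrtr_ge0 (k.+2%:R : R).
rewrite -[k.+2%:R]natr1 -[k.+1%:R]natr1.
set t := k%:R; set x := Num.sqrt t; set y := Num.sqrt (t + 1).
set z := Num.sqrt (t + 1 + 1) => z0 y0 x0 zz yy xx.
(* Concavity of the square root: [(z + x)^2 <= 2 (z^2 + x^2) = 4 y^2]. *)
suff : z + x <= 2 * y by lra.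
rewrite -ler_sqr ?nnegrE ?addr_ge0 ?mulr_ge0 //.
have := sqr_ge0 (z - x); nra.
Qed.

(** The windows of lengths 2 and 3 have weights at least 1/25 and together dominate half of the sum
    of squares. The full form thus gains 1/50, and its lower triangular half gains 1/100. *)
Lemma abel_coef_form_lower (R : realType) (n : nat) (x : 'I_n -> R) :
  - (3 - Num.sqrt 2 - 1 / 100) * \sum_(i < n) x i ^+ 2 <=
  \sum_(i < n) \sum_(j < n | (j < i)%N) abel_coef R (i - j) * (x i * x j).
Proof.
have := toeplitz_form_convex _ _ _ x (abel_coef_ge0 R) (abel_coef_decr R)
  (abel_coef_convex R).
rewrite (toeplitz_form_sym _ _ (abel_coef R)); have := sum_sqr_le_windows _ _ x.
have T2 := triangle_form_ge0 _ _ 2 x; have T3 := triangle_form_ge0 _ _ 3 x.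
have d1 : 1 / 25 <= second_diff (abel_coef R) 1.
  rewrite /second_diff /= sqrtr0 sqrtr1.
  by have := sqrt2_bounds R; have := sqrt3_bounds R; lra.
have d2 : 1 / 25 <= second_diff (abel_coef R) 2.
  rewrite /second_diff /= sqrtr1 sqrt4.
  by have := sqrt2_bounds R; have := sqrt3_bounds R; lra.
have -> : abel_coef R 0 = 2 * (3 - Num.sqrt 2) by [].
have := ler_wpM2r T2 d1; have := ler_wpM2r T3 d2; lra.
Qed.

(** * Energy estimate and stability *)

Lemma euler_energy (R : realType) (h : R) (N : nat) (f s : 'cV[R]_N.+1) :
  euler_solution h f s ->
  \sum_i s i 0 ^+ 2 + Num.sqrt h * \sum_(i < N.+1) \sum_(j < N.+1 | (j < i)%N)
    abel_coef R (i - j) * (s i 0 * s j 0) = 2 * \sum_i f i 0 * s i 0.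
Proof.
move=> sol; rewrite !mulr_sumr -big_split; apply: eq_bigr => i _ /=.
(* Row [i] of the system is multiplied by [s i 0]; summed over [i], this is the scalar product with
   [s]. *)
have /matrixP/(_ i 0) := sol; rewrite mulmxDl mul1mx !mxE => E.
rewrite mulrA -E mulrDl expr2; congr (_ + _).
rewrite mulr_sumr mulr_suml big_mkcond /=; apply: eq_bigr => j _.
rewrite !mxE; case: ltnP => ji; last by rewrite !mul0r.
by rewrite /abel_v; case: (i - j)%N (subn_gt0 j i) => [|d _] /=; [lia | ring].
Qed.

Lemma euler_bound (R : realType) (c h : R) (N : nat) (f s : 'cV[R]_N.+1) :
  c = 3 - Num.sqrt 2 - 1 / 100 -> 0 < 1 - c * Num.sqrt h ->
  euler_solution h f s ->
  l2norm s <= 2 / (1 - c * Num.sqrt h) * l2norm f.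
Proof.
move=> cE; set q := 1 - _ => q_gt0 /euler_energy.
have := abel_coef_form_lower _ _ (fun i => s i 0); rewrite -cE.
rewrite /l2norm; set E := \sum_(i < _) s i 0 ^+ 2; set F := \sum_(i < _) f i 0 ^+ 2.
set L := \sum_(i < _) \sum_(j < _ | _) _; set P := \sum_i _ * _ => cL energy.
have qE : q * E <= 2 * P.
  by have := ler_wpM2l (sqrtr_ge0 h) cL; rewrite /q; nra.
(* This weighted Young inequality stands in for Cauchy-Schwarz; with [qE] it gives [q^2 E <= 4 F]
   without dividing by the norm of [s]. *)
have young : 4 * (q * P) <= q ^+ 2 * E + 4 * F.
  have : 0 <= \sum_i (q * s i 0 - 2 * f i 0) ^+ 2.
    by apply: sumr_ge0 => i _; exact: sqr_ge0.
  rewrite (eq_bigr (fun i => q ^+ 2 * s i 0 ^+ 2 + (- (4 * q)) * (f i 0 * s i 0)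
    + 4 * f i 0 ^+ 2)) => [|i _]; last by ring.
  by rewrite !big_split /= -!mulr_sumr -/E -/F -/P; lra.
have main : E <= (2 / q) ^+ 2 * F.
  have := ler_wpM2l (ltW q_gt0) qE; rewrite mulrA -expr2 => qqE.
  by rewrite expr_div_n mulrAC ler_pdivlMr ?exprn_gt0 //; lra.
have q2 : 0 <= 2 / q by rewrite divr_ge0 // ltW.
by rewrite -[2 / q]ger0_norm // -sqrtr_sqr -sqrtrM ?sqr_ge0 // ler_wsqrtr.
Qed.

Theorem theorem6 (R : realType) :
  exists c : R,
    [/\ 0 < c < 3 - Num.sqrt 2,
        39 / 100 < (1 / c) ^+ 2
      & forall kappa dt : R, 0 < kappa -> 0 < dt ->
        [/\ abel_h kappa dt < (1 / c) ^+ 2 ->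
            forall N : nat, (1 <= N)%N ->
            forall f sigma : 'cV[R]_N.+1,
              euler_solution (abel_h kappa dt) f sigma ->
              l2norm sigma <=
                2 / (1 - c * Num.sqrt (abel_h kappa dt)) * l2norm f,
            abel_h kappa dt < 39 / 100 -> euler_stable (abel_h kappa dt)
          & dt < pi / (c ^+ 2 * kappa ^+ 2) ->
            euler_stable (abel_h kappa dt)]].
Proof.
have [c cE] : {c : R | c = 3 - Num.sqrt 2 - 1 / 100} by eexists.
(* The upper bound is sharp enough for [c39], since [0.39 * 1.59^2 < 1]. *)
have c_bounds : 1 < c < 159 / 100 by rewrite cE; have := sqrt2_bounds R; lra.
have c_gt0 : 0 < c by lra.
have c39 : 39 / 100 < (1 / c) ^+ 2.
  by rewrite expr_div_n ltr_pdivlMr ?exprn_gt0 //; nra.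
exists c; split=> //; first by rewrite cE in c_gt0 *; lra.
move=> kappa dt kappa_gt0 dt_gt0.
have bound : abel_h kappa dt < (1 / c) ^+ 2 ->
    forall N : nat, (1 <= N)%N -> forall f sigma : 'cV[R]_N.+1,
      euler_solution (abel_h kappa dt) f sigma ->
      l2norm sigma <= 2 / (1 - c * Num.sqrt (abel_h kappa dt)) * l2norm f.
  move=> hc N _ f sigma; apply: euler_bound => //.
  have : Num.sqrt (abel_h kappa dt) < Num.sqrt ((1 / c) ^+ 2).
    by rewrite ltr_sqrt // exprn_gt0 // divr_gt0.
  rewrite sqrtr_sqr ger0_norm ?divr_ge0 ?(ltW c_gt0) // ltr_pdivlMr //; lra.
split=> // hyp; exists (2 / (1 - c * Num.sqrt (abel_h kappa dt))) => N f sigma N1;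
  apply: bound => //.
  exact: lt_trans c39.
(* The bound on [dt] is [h < (1 / c)^2] with the denominators cleared. *)
move: hyp; rewrite /abel_h ltr_pdivrMr ?pi_gt0 // expr_div_n expr1n.
rewrite ltr_pdivlMr ?mulr_gt0 ?exprn_gt0 // => hyp.
rewrite [ltRHS]mulrAC ltr_pdivlMr ?exprn_gt0 //; lra.
Qed.
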